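(* Let $\mathbb{F}$ be a field and let $P_0(\bar x,\bar z)$ and $P_1(\bar y,\bar z)$ be finite sets of polynomials over $\mathbb{F}$, where $\bar x,\bar y,\bar z$ are pairwise disjoint tuples of variables, and the polynomials of $P_0$ have degree and sparsity $\mathrm{poly}(|\bar x|+|\bar z|)$. Assume $P_0$ is in $\bar z$-normal form. Suppose that $P_0\cup P_1$ has an $\mathrm{roABP}$-$\mathrm{IPS}_{\mathrm{LIN}}$ refutation of width $w$ in a variable ordering in which all $\bar x$ variables precede all other variables. Then there is a span program of size $\mathrm{poly}(w\cdot|P_0|)$ that computes an interpolant for $P_0$ and $P_1$. Moreover, if $P_0$ is in monotone $\bar z$-normal form, then the span program is monotone.
   Context: An roABP in the variable ordering $x_1<\cdots<x_n$ is a sequence of matrices $M_1,\ldots,M_n$ whose entries in $M_i$ are univariate polynomials in $x_i$; it computes the $(1,1)$ entry of $M_1\cdots M_n$; its width is the maximal dimension of the matrices. An $\mathrm{roABP}$-$\mathrm{IPS}_{\mathrm{LIN}}$ refutation of a finite set $Q$ of polynomials in a given variable ordering is a family $(g_q)_{q\in Q}$ with $\sum_{q\in Q}g_q q=1$ as formal polynomials, each $g_q$ computed by an roABP in that ordering; its width is the maximal width of these roABPs. The sparsity of a polynomial is its number of monomials. $P_0$ is in $\bar z$-normal form if each of its polynomials has the form $p+z_ip'$ with $p,p'$ polynomials in $\bar x$ only and $z_i$ a single $\bar z$-variable (or contains no $\bar z$-variable); it is in monotone $\bar z$-normal form if each polynomial has the form $z_ip'$ or $p'$ with $p'$ a polynomial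 in $\bar x$ only. A Boolean function $I(\bar z)$ is an interpolant for $P_0,P_1$ if for every $\bar\alpha\in\{0,1\}^{|\bar z|}$: $I(\bar\alpha)=0$ whenever $P_0(\bar x,\bar\alpha)$ has a common zero with $\bar x\in\{0,1\}^{|\bar x|}$, and $I(\bar\alpha)=1$ whenever $P_1(\bar y,\bar\alpha)$ has a common zero with $\bar y\in\{0,1\}^{|\bar y|}$. A span program is a finite set $U$ of pairs $(\ell,v)$, where $\ell$ is a $\bar z$-literal or the constant $1$ and $v$ is a vector in a vector space $V$ over $\mathbb{F}$, together with a target vector $t\in V$; on $a\in\{0,1\}^{|\bar z|}$ it outputs $1$ iff $t$ lies in the span of $\{v:(\ell,v)\in U,\ \ell(a)=1\}$. Its size is $|U|$; it is monotone if no negative literal occurs as a label. $|P_0|$ denotes the number of polynomials in $P_0$. *)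

(* Defs.v *)
From HB Require Import structures.
From mathcomp Require Export all_boot all_order all_algebra.
From mathcomp Require Export finmap.
From mathcomp Require Export mpoly.

Set Implicit Arguments.
Unset Strict Implicit.
Unset Printing Implicit Defensive.

Import GRing.Theory.
Local Open Scope ring_scope.

(* The polynomials of P0 live in {mpoly F[nx + nz]}, those of P1 in
   {mpoly F[ny + nz]}, and the refutation in {mpoly F[nx + (ny + nz)]}; in each
   case the blocks of variables are laid out in the order x, y, z. *)

Definition mrename (F : fieldType) (m n : nat) (f : 'I_m -> 'I_n)
    (p : {mpoly F[m]}) : {mpoly F[n]} :=
  mmap (@mpolyC n F) (fun i => 'X_(f i)) p.

Definition xz_var (nx ny nz : nat) (k : 'I_(nx + nz)) : 'I_(nx + (ny + nz)) :=
  match split k with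
  | inl i => lshift (ny + nz) i
  | inr j => rshift nx (rshift ny j)
  end.

Definition joint_system (F : fieldType) (nx ny nz : nat)
    (P0 : {fset {mpoly F[nx + nz]}}) (P1 : {fset {mpoly F[ny + nz]}}) :
    {fset {mpoly F[nx + (ny + nz)]}} :=
  ([fset mrename (@xz_var nx ny nz) q | q in P0]
     `|` [fset mrename (@rshift nx (ny + nz)) q | q in P1])%fset.

Definition degree (F : fieldType) (n : nat) (q : {mpoly F[n]}) : nat :=
  (msize q).-1.

Definition sparsity (F : fieldType) (n : nat) (q : {mpoly F[n]}) : nat :=
  size (msupp q).

Definition z_normal_form (F : fieldType) (nx nz : nat)
    (P : {fset {mpoly F[nx + nz]}}) : Prop :=
  forall q, q \in P ->
    (exists p : {mpoly F[nx]}, q = mrename (@lshift nx nz) p) \/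
    (exists (i : 'I_nz) (p p' : {mpoly F[nx]}),
       q = mrename (@lshift nx nz) p
             + 'X_(rshift nx i) * mrename (@lshift nx nz) p').

Definition monotone_z_normal_form (F : fieldType) (nx nz : nat)
    (P : {fset {mpoly F[nx + nz]}}) : Prop :=
  forall q, q \in P ->
    (exists p' : {mpoly F[nx]}, q = mrename (@lshift nx nz) p') \/
    (exists (i : 'I_nz) (p' : {mpoly F[nx]}),
       q = 'X_(rshift nx i) * mrename (@lshift nx nz) p').

(* All dimensions are successors, so that the (1,1) entry exists.  The number
   of matrices is that of the variables: only the first n matrices are used by
   the polynomial and the width below, the others are irrelevant. *)
Record roABP (F : fieldType) := RoABP {
  abp_dim : nat -> nat;
  abp_mx : forall k, 'M[{poly F}]_((abp_dim k).+1, (abp_dim k.+1).+1)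
}.

(* M_1 ... M_n, where M_k is read in the k-th variable of s. *)
Fixpoint abp_prod (F : fieldType) (n : nat) (s : seq 'I_n) :
    forall (d : nat -> nat)
           (M : forall k, 'M[{poly F}]_((d k).+1, (d k.+1).+1)),
      'M[{mpoly F[n]}]_((d 0%N).+1, (d (size s)).+1) :=
  match s with
  | [::] => fun d M => 1%:M
  | x :: s' => fun d M =>
      map_mx (fun p : {poly F} => (map_poly (@mpolyC n F) p).['X_x]) (M 0%N)
        *m abp_prod s' (fun k => M k.+1)
  end.

Definition abp_poly (F : fieldType) (n : nat) (s : seq 'I_n) (A : roABP F) :
    {mpoly F[n]} :=
  abp_prod s (abp_mx A) ord0 ord0.

Definition abp_width (F : fieldType) (n : nat) (A : roABP F) : nat :=
  \max_(k < n) maxn (abp_dim A k).+1 (abp_dim A k.+1).+1.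

Definition variable_ordering (n : nat) (s : seq 'I_n) : Prop :=
  perm_eq s (enum 'I_n).

Definition x_first (nx m : nat) (s : seq 'I_(nx + m)) : Prop :=
  forall (i : 'I_nx) (j : 'I_m),
    (index (lshift m i) s < index (rshift nx j) s)%N.

Definition roABP_IPS_LIN_refutation (F : fieldType) (n : nat) (s : seq 'I_n)
    (Q : {fset {mpoly F[n]}}) (w : nat) : Prop :=
  exists (g : {mpoly F[n]} -> {mpoly F[n]}) (A : {mpoly F[n]} -> roABP F),
    [/\ forall q, q \in Q -> g q = abp_poly s (A q),
        \sum_(q <- Q) g q * q = 1
      & w = \max_(q <- Q) abp_width n (A q)].

Definition bool_point (F : fieldType) (m n : nat)
    (b : {ffun 'I_m -> bool}) (a : {ffun 'I_n -> bool}) (k : 'I_(m + n)) : F :=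
  match split k with inl i => (b i)%:R | inr j => (a j)%:R end.

Definition has_bool_zero (F : fieldType) (m n : nat)
    (P : {fset {mpoly F[m + n]}}) (a : {ffun 'I_n -> bool}) : Prop :=
  exists b : {ffun 'I_m -> bool}, forall q, q \in P -> q.@[bool_point F b a] = 0.

Definition interpolant (F : fieldType) (nx ny nz : nat)
    (P0 : {fset {mpoly F[nx + nz]}}) (P1 : {fset {mpoly F[ny + nz]}})
    (I : {ffun 'I_nz -> bool} -> bool) : Prop :=
  forall a : {ffun 'I_nz -> bool},
    (has_bool_zero P0 a -> I a = false) /\ (has_bool_zero P1 a -> I a = true).

(* None is the constant 1; Some (i, true) and Some (i, false) are the positive
   and the negative literal of z_i. *)
Definition label (n : nat) : choiceType := option ('I_n * bool)%type.

Definition label_holds (n : nat) (a : {ffun 'I_n -> bool}) (l : label n) : bool :=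
  match l with Some (i, b) => a i == b | None => true end.

Definition negative_label (n : nat) (l : label n) : bool :=
  match l with Some (_, false) => true | _ => false end.

Record span_program (F : fieldType) (n : nat) := SpanProgram {
  sp_space : lmodType F;
  sp_vectors : {fset (label n * sp_space)%type};
  sp_target : sp_space
}.

Definition sp_size (F : fieldType) (n : nat) (S : span_program F n) : nat :=
  #|` sp_vectors S|%fset.

Definition sp_monotone (F : fieldType) (n : nat) (S : span_program F n) : Prop :=
  forall u, u \in sp_vectors S -> ~~ negative_label u.1.

Definition sp_accepts (F : fieldType) (n : nat) (S : span_program F n)
    (a : {ffun 'I_n -> bool}) : Prop :=
  exists c : label n * sp_space S -> F,
    sp_target S = \sum_(u <- sp_vectors S | label_holds a u.1) c u *: u.2.

Definition sp_computes (F : fieldType) (n : nat) (S : span_program F n)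
    (I : {ffun 'I_n -> bool} -> bool) : Prop :=
  forall a, I a = true <-> sp_accepts S a.

(* Main.v *)
(** Cut every roABP of the refutation right after the block of x-variables:
    each multiplier becomes a sum of at most w products u(x) v(y,z).  The span
    program lives in F[x], has target 1, and for q = p + z_i p' in P0 it has the
    vectors u p (label: not z_i) and u (p + p') (label: z_i), so that the vectors
    available at z = a are the u(x) q(x,a).  If they span 1, then P0(x,a) has no
    common zero.  If P1(y,a) vanishes at y = c, then substituting y = c, z = a in
    the refutation kills the P1 part, turns each v into a scalar, and hence writes
    1 as a combination of the available vectors. *)

From HB Require Import structures.
Require Import Defs.
From Stdlib Require Import ClassicalEpsilon.

Set Implicit Arguments.
Unset Strict Implicit.
Unset Printing Implicit Defensive.

Import GRing.Theory.
Local Open Scope ring_scope.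

(** * Renaming of variables as a ring morphism *)

Lemma rmorph_mmap (n : nat) (R : nzRingType) (S T : comNzRingType)
    (f : {rmorphism R -> S}) (h : 'I_n -> S) (theta : {rmorphism S -> T})
    (p : {mpoly R[n]}) :
  theta (mmap f h p) = mmap (theta \o f) (theta \o h) p.
Proof.
rewrite /mmap rmorph_sum; apply: eq_bigr => m _ /=.
rewrite rmorphM rmorph_prod; congr (_ * _).
by apply: eq_bigr => i _; rewrite rmorphXn.
Qed.

Lemma eq_mmap (n : nat) (R S : nzRingType) (f1 f2 : R -> S)
    (h1 h2 : 'I_n -> S) (p : {mpoly R[n]}) :
  f1 =1 f2 -> h1 =1 h2 -> mmap f1 h1 p = mmap f2 h2 p.
Proof.
move=> eq_f eq_h; apply: eq_bigr => m _.
by rewrite eq_f; congr (_ * _); apply: mmap1_eq.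
Qed.

Lemma mmap_mrename (F : fieldType) (S : comNzRingType) (m n : nat)
    (f : {rmorphism F -> S}) (h : 'I_n -> S) (r : 'I_m -> 'I_n)
    (p : {mpoly F[m]}) :
  mmap f h (mrename r p) = mmap f (h \o r) p.
Proof.
rewrite /mrename rmorph_mmap; apply: eq_mmap => [c|i] /=.
  exact: mmapC.
by rewrite mmapX mmap1U.
Qed.

Section Mrename.
Variables (F : fieldType) (m n : nat) (r : 'I_m -> 'I_n).

HB.instance Definition _ :=
  GRing.RMorphism.copy (@mrename F m n r) (mmap (@mpolyC n F) (fun i => 'X_(r i))).

Lemma mrenameX (i : 'I_m) : mrename r ('X_i : {mpoly F[m]}) = 'X_(r i).
Proof. by rewrite /mrename mmapX mmap1U. Qed.

Lemma mrename_horner (p : {poly F}) (i : 'I_m) :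
  (map_poly (@mpolyC n F) p).['X_(r i)] =
  mrename r (map_poly (@mpolyC m F) p).['X_i].
Proof.
rewrite -horner_map /= mrenameX -map_poly_comp; congr (_.[_]).
by apply: eq_map_poly => c /=; rewrite /mrename mmapC.
Qed.

(** The matrices have entries in the image of [mrename r], which is a subring, so their product
    stays in it. *)
Lemma abp_prod_mrename (t : seq 'I_m) (d : nat -> nat)
    (M : forall k, 'M[{poly F}]_((d k).+1, (d k.+1).+1)) i j :
  exists v : {mpoly F[m]}, abp_prod (map r t) M i j = mrename r v.
Proof.
elim: t d M i j => [|x t IH] d M i j /=.
  by rewrite mxE; exists (i == j)%:R; rewrite rmorph_nat.
have /fin_all_exists [v Ev] k := IH _ (fun k => M k.+1) k j.
exists (\sum_k (map_poly (@mpolyC m F) (M 0%N i k)).['X_x] * v k).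
rewrite mxE rmorph_sum; apply: eq_bigr => k _.
by rewrite mxE Ev rmorphM mrename_horner.
Qed.

End Mrename.

(** * Cutting an roABP between two blocks of variables *)

(** The sum runs over the inner dimension at the cut. The right factors [v] are column [j] of the
    second block's product and do not depend on the row [i]; the induction mixes rows and needs one
    [v] for all of them. *)
Lemma abp_prod_cut (F : fieldType) (m1 m2 n : nat)
    (r1 : 'I_m1 -> 'I_n) (r2 : 'I_m2 -> 'I_n) (t1 : seq 'I_m1) (t2 : seq 'I_m2)
    (d : nat -> nat) (M : forall k, 'M[{poly F}]_((d k).+1, (d k.+1).+1)) j :
  exists v : 'I_(d (size t1)).+1 -> {mpoly F[m2]}, forall i,
  exists u : 'I_(d (size t1)).+1 -> {mpoly F[m1]},
    abp_prod (map r1 t1 ++ map r2 t2) M i j =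
    \sum_k mrename r1 (u k) * mrename r2 (v k).
Proof.
elim: t1 d M j => [|x t1 IH] d M j /=.
  have /fin_all_exists [v Ev] k := @abp_prod_mrename F m2 n r2 t2 d M k j.
  (* With an empty first block, row [i] of the identity matrix selects [v i]. *)
  exists v => i; exists (fun k => (i == k)%:R).
  rewrite (bigD1 i) //= eqxx rmorph1 mul1r -Ev big1 ?addr0 // => k ne_ki.
  by rewrite eq_sym (negbTE ne_ki) rmorph0 mul0r.
have [v /fin_all_exists [u Eu]] := IH _ (fun k => M k.+1) j.
exists v => i.
exists (fun k => \sum_l (map_poly (@mpolyC m1 F) (M 0%N i l)).['X_x] * u l k).
under [RHS]eq_bigr => k _ do rewrite rmorph_sum mulr_suml.
rewrite exchange_big mxE; apply: eq_bigr => l _ /=.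
rewrite mxE Eu mulr_sumr; apply: eq_bigr => k _.
by rewrite rmorphM mrename_horner mulrA.
Qed.

Lemma x_first_cat (nx m : nat) (s : seq 'I_(nx + m)) :
  variable_ordering s -> x_first s ->
  exists t1 t2, s = map (@lshift nx m) t1 ++ map (@rshift nx m) t2.
Proof.
move=> /perm_uniq; rewrite enum_uniq => uniq_s xf.
(* Restricted to the variables that occur in [s], the order condition passes to tails. *)
have {xf} : forall i j, lshift m i \in s -> rshift nx j \in s ->
    (index (lshift m i) s < index (rshift nx j) s)%N by [].
elim: s uniq_s => [_ _|x s IH /andP [x_s uniq_s] xf]; first by exists [::], [::].
have [i Ex|j Ex] := splitP x.
  have {}Ex : x = lshift m i by apply: val_inj.
  have [|i' j' i's j's|t1 [t2 Es]] := IH; first by [].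
    have := xf i' j'; rewrite !inE i's j's !orbT => /(_ isT isT) /=.
    have neq y : y \in s -> (x == y) = false.
      by move=> ys; apply: contraNF x_s => /eqP ->.
    by rewrite !neq.
  by exists (i :: t1), t2; rewrite Es Ex.
have {}Ex : x = rshift nx j by apply: val_inj.
exists [::], (j :: pmap (fun y => if split y is inr j then Some j else None) s).
rewrite /= -Ex; congr (_ :: _).
(* An x-variable in the tail would need an index below that of the head, which is 0. *)
have : {in s, forall i, exists j, i = rshift nx j}.
  move=> y ys; have [i Ey|j' Ey] := splitP y; last by exists j'; apply: val_inj.
  have {}Ey : y = lshift m i by apply: val_inj.
  by have := xf i j; rewrite -Ex -Ey !inE ys eqxx orbT /= eqxx => /(_ isT isT).
elim: s {IH uniq_s xf x_s} => //= y s IH all_r.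
have [|j' Ej'] := all_r y; first by rewrite inE eqxx.
rewrite {1}Ej' -[rshift nx j']/(unsplit (inr j')) Ej'.
rewrite -[X in split X]/(unsplit (inr j')) unsplitK /=; congr (_ :: _).
by apply: IH => z zs; apply: all_r; rewrite inE zs orbT.
Qed.

(** For [k < n] this is the left dimension of matrix [k], counted from 0; for [k = n] it is the
    right dimension of the last matrix, which exists because [0 < n]. *)
Lemma abp_dim_width (F : fieldType) (n k : nat) (A : roABP F) :
  (0 < n)%N -> (k <= n)%N -> ((abp_dim A k).+1 <= abp_width n A)%N.
Proof.
move=> n_gt0; rewrite leq_eqVlt => /orP [/eqP ->|lt_kn].
  case: n n_gt0 => // n _; rewrite /abp_width.
  by apply: leq_trans (leq_bigmax (@ord_max n)); rewrite leq_maxr.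
rewrite /abp_width.
by apply: leq_trans (leq_bigmax (Ordinal lt_kn)); rewrite leq_maxl.
Qed.

(** * Fixing the values of all variables except the x-variables *)

Definition xsubst (F : fieldType) (nx m : nat) (c : 'I_m -> F) :
    {mpoly F[nx + m]} -> {mpoly F[nx]} :=
  mmap (@mpolyC nx F)
    (fun k => match split k with inl i => 'X_i | inr j => (c j)%:MP end).

Section Xsubst.
Variables (F : fieldType) (nx m : nat) (c : 'I_m -> F).

HB.instance Definition _ :=
  GRing.RMorphism.copy (@xsubst F nx m c) (mmap (@mpolyC nx F)
    (fun k => match split k with inl i => 'X_i | inr j => (c j)%:MP end)).

Lemma split_lshift i : split (lshift m i) = inl i :> 'I_nx + 'I_m.
Proof. exact: (unsplitK (inl i)). Qed.

Lemma split_rshift j : split (rshift nx j) = inr j :> 'I_nx + 'I_m.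
Proof. exact: (unsplitK (inr j)). Qed.

Lemma xsubst_lshift (p : {mpoly F[nx]}) :
  xsubst c (mrename (@lshift nx m) p) = p.
Proof.
rewrite /xsubst mmap_mrename.
rewrite (@eq_mmap _ _ _ _ (@mpolyC nx F) _ (fun i => 'X_i)) //; last first.
  by move=> i /=; rewrite split_lshift.
rewrite [RHS]mpolyE; apply: eq_bigr => k _.
by rewrite mmap1_id mul_mpolyC.
Qed.

Lemma xsubst_rshift (p : {mpoly F[m]}) :
  xsubst c (mrename (@rshift nx m) p) = (p.@[c])%:MP.
Proof.
rewrite /xsubst mmap_mrename /meval rmorph_mmap.
by apply: eq_mmap => // i /=; rewrite split_rshift.
Qed.

Lemma xsubstX (j : 'I_m) : xsubst c ('X_(rshift nx j)) = (c j)%:MP.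
Proof. by rewrite /xsubst mmapX mmap1U split_rshift. Qed.

End Xsubst.

Definition bool_val (F : fieldType) (n : nat) (a : {ffun 'I_n -> bool})
  (j : 'I_n) : F := (a j)%:R.

(** No y-variable occurs in a polynomial of [P0], so the y-part [c] of the point drops out. *)
Lemma xsubst_xz (F : fieldType) (nx ny nz : nat) (c : {ffun 'I_ny -> bool})
    (a : {ffun 'I_nz -> bool}) (q : {mpoly F[nx + nz]}) :
  xsubst (bool_point F c a) (mrename (@xz_var nx ny nz) q) =
  xsubst (bool_val F a) q.
Proof.
rewrite /xsubst mmap_mrename; apply: eq_mmap => // k /=.
rewrite /xz_var; case: (split k) => [i|j].
  by rewrite split_lshift.
by rewrite split_rshift /bool_point split_rshift.
Qed.

Lemma meval_xsubst (F : fieldType) (nx nz : nat) (b : {ffun 'I_nx -> bool})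
    (a : {ffun 'I_nz -> bool}) (q : {mpoly F[nx + nz]}) :
  (xsubst (bool_val F a) q).@[bool_val F b] = q.@[bool_point F b a].
Proof.
rewrite /xsubst rmorph_mmap; apply: eq_mmap => [x|k] /=; first exact: mevalC.
rewrite /bool_point; case: (split k) => [i|j]; first exact: mevalXU.
exact: mevalC.
Qed.

(** * Spans of the vectors available at an assignment *)

Section Span.
Variables (F : fieldType) (n : nat) (V : lmodType F).
Variables (A : {fset (label n * V)%type}) (a : {ffun 'I_n -> bool}).

(** The acceptance condition [sp_accepts] with the target left arbitrary, so that closure properties
    can be stated. *)
Definition in_span (t : V) : Prop :=
  exists c : label n * V -> F, t = \sum_(u <- A | label_holds a u.1) c u *: u.2.

Lemma in_span0 : in_span 0.
Proof. by exists (fun=> 0); rewrite big1 // => u _; rewrite scale0r. Qed.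

Lemma in_spanD t1 t2 : in_span t1 -> in_span t2 -> in_span (t1 + t2).
Proof.
move=> [c1 ->] [c2 ->]; exists (fun u => c1 u + c2 u).
by rewrite -big_split; apply: eq_bigr => u _; rewrite scalerDl.
Qed.

Lemma in_spanZ x t : in_span t -> in_span (x *: t).
Proof.
move=> [c ->]; exists (fun u => x * c u).
by rewrite scaler_sumr; apply: eq_bigr => u _; rewrite scalerA.
Qed.

Lemma in_span_mem l v : (l, v) \in A -> label_holds a l -> in_span v.
Proof.
move=> lvA al; exists (fun u => (u == (l, v))%:R).
rewrite big_mkcond (bigD1_seq (l, v)) ?fset_uniq //= al eqxx scale1r.
rewrite big1 ?addr0 // => u /negbTE ->.
by case: ifP => // _; rewrite scale0r.
Qed.

(** Applied to evaluation at a Boolean zero of [P0], this shows that 1 is not spanned. *)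
Lemma in_span_eval (phi : {scalar V}) t :
  (forall l v, (l, v) \in A -> label_holds a l -> phi v = 0) ->
  in_span t -> phi t = 0.
Proof.
move=> phi0 [c ->]; rewrite raddf_sum big_seq_cond big1 //= => -[l v] /andP [lvA al].
by rewrite linearZ /= (phi0 l) // mulr0.
Qed.

End Span.

(* The monotone form is preferred when available: it needs no vector labelled by
   a negative literal, as q(x,a) = 0 when z_i = 0. *)
Lemma labelled_restrictions (F : fieldType) (nx nz : nat)
    (P : {fset {mpoly F[nx + nz]}}) (q : {mpoly F[nx + nz]}) :
  z_normal_form P -> q \in P ->
  exists D : seq (label nz * {mpoly F[nx]}),
    [/\ (size D <= 2)%N,
        forall a d, d \in D -> label_holds a d.1 -> d.2 = xsubst (bool_val F a) q,
        forall a, xsubst (bool_val F a) q = 0 \/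
          exists2 d, d \in D & label_holds a d.1
      & monotone_z_normal_form P -> forall d, d \in D -> ~~ negative_label d.1].
Proof.
move=> nfP qP.
have [[p ->]|not_pure] :=
  classic (exists p : {mpoly F[nx]}, q = mrename (@lshift nx nz) p).
  exists [:: (None, p)]; split=> // [a d|a|_ d].
  - by rewrite inE => /eqP -> _; rewrite xsubst_lshift.
  - by right; exists (None, p); rewrite ?inE.
  - by rewrite inE => /eqP ->.
have [[i [p ->]]|not_mono] := classic (exists (i : 'I_nz) (p : {mpoly F[nx]}),
    q = 'X_(rshift nx i) * mrename (@lshift nx nz) p).
  exists [:: (Some (i, true), p)].
  have E a : xsubst (bool_val F a)
      ('X_(rshift nx i) * mrename (@lshift nx nz) p) = (a i)%:R%:MP * p.
    by rewrite rmorphM /= xsubstX xsubst_lshift.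
  split=> // [a d|a|_ d].
  - by rewrite inE E => /eqP -> /= /eqP ->; rewrite mpolyC1 mul1r.
  - rewrite E; case ai: (a i); last by left; rewrite mpolyC0 mul0r.
    by right; exists (Some (i, true), p); rewrite ?inE //= ai.
  - by rewrite inE => /eqP ->.
have [//|[i [p [p' Eq]]]] := nfP q qP.
exists [:: (Some (i, false), p); (Some (i, true), p + p')].
have E a : xsubst (bool_val F a) q = p + (a i)%:R%:MP * p'.
  by rewrite Eq rmorphD rmorphM /= xsubstX !xsubst_lshift.
split=> // [a d|a|monoP].
- rewrite !inE E => /orP [] /eqP -> /= /eqP ->.
    by rewrite mpolyC0 mul0r addr0.
  by rewrite mpolyC1 mul1r.
- right; case ai: (a i).
    by exists (Some (i, true), p + p'); rewrite ?inE ?eqxx ?orbT //= ai.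
  by exists (Some (i, false), p); rewrite ?inE ?eqxx //= ai.
(* Both shapes allowed by the monotone form were excluded above. *)
- by have [] := monoP q qP.
Qed.

(** * The joint system and the vectors of its axioms *)

Lemma joint_systemP (F : fieldType) (nx ny nz : nat)
    (P0 : {fset {mpoly F[nx + nz]}}) (P1 : {fset {mpoly F[ny + nz]}}) q :
  q \in joint_system P0 P1 ->
  (exists2 p, p \in P0 & q = mrename (@xz_var nx ny nz) p) \/
  (exists2 p, p \in P1 & q = mrename (@rshift nx (ny + nz)) p).
Proof.
by rewrite in_fsetU => /orP [] /imfsetP [p /= pP ->]; [left | right]; exists p.
Qed.

(** Evaluating the refutation identity at common zeros of both parts kills every summand and leaves
    1 = 0. *)
Lemma refutation_disjoint (F : fieldType) (nx ny nz : nat)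
    (P0 : {fset {mpoly F[nx + nz]}}) (P1 : {fset {mpoly F[ny + nz]}})
    (g : {mpoly F[nx + (ny + nz)]} -> {mpoly F[nx + (ny + nz)]})
    (a : {ffun 'I_nz -> bool}) :
  \sum_(q <- joint_system P0 P1) g q * q = 1 ->
  has_bool_zero P0 a -> has_bool_zero P1 a -> False.
Proof.
move=> Eg [b b0] [c c0].
have: (xsubst (bool_point F c a) 1).@[bool_val F b] = 0.
  rewrite -Eg big_seq.
  apply: (big_ind (fun p => (xsubst (bool_point F c a) p).@[bool_val F b] = 0)).
  + by rewrite rmorph0 meval0.
  + by move=> p1 p2 E1 E2; rewrite rmorphD /= mevalD E1 E2 addr0.
  move=> q /joint_systemP [] [p pP ->]; rewrite rmorphM mevalM /=.
  + by rewrite xsubst_xz meval_xsubst b0 ?mulr0.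
  + by rewrite xsubst_rshift c0 // mpolyC0 meval0 mulr0.
by move/eqP; rewrite rmorph1 meval1 oner_eq0.
Qed.

(* Without variables the width is 0 whatever the matrices are, so the size bound
   leaves no room for a vector. *)
Lemma constant_span_program (F : fieldType) (nz : nat) (bit : bool) :
  exists S : span_program F nz,
    [/\ sp_size S = 0%N, sp_computes S (fun=> bit) & sp_monotone S].
Proof.
exists (@SpanProgram F nz F^o fset0 (~~ bit)%:R); split=> // a.
have sum0 (c : label nz * F^o -> F) :
    \sum_(u <- fset0 | label_holds a u.1) c u *: u.2 = 0 :> F^o.
  by rewrite big_seq_cond big1 // => u /andP [].
rewrite /sp_accepts /=; split=> [->|[c]].
  by exists (fun=> 0); rewrite sum0.
by rewrite sum0; case: bit => // /eqP; rewrite oner_eq0.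
Qed.

(* L collects the vectors contributed by an axiom q of P whose multiplier is g. *)
Definition axiom_vectors (F : fieldType) (nx ny nz : nat)
    (P : {fset {mpoly F[nx + nz]}}) (w : nat) (g : {mpoly F[nx + (ny + nz)]})
    (q : {mpoly F[nx + nz]}) (L : seq (label nz * {mpoly F[nx]})) : Prop :=
  [/\ (size L <= 2 * w)%N,
      forall a d, d \in L -> label_holds a d.1 ->
        exists u, d.2 = u * xsubst (bool_val F a) q,
      forall (B : {fset (label nz * {mpoly F[nx]})%type})
          (c : {ffun 'I_ny -> bool}) a, {subset L <= B} ->
        in_span B a (xsubst (bool_point F c a) g * xsubst (bool_val F a) q)
    & monotone_z_normal_form P -> forall d, d \in L -> ~~ negative_label d.1].

Lemma axiom_vectors_exist (F : fieldType) (nx ny nz : nat)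
    (P : {fset {mpoly F[nx + nz]}}) (q : {mpoly F[nx + nz]})
    (s : seq 'I_(nx + (ny + nz))) (A : roABP F) (w : nat) :
  (0 < nx + (ny + nz))%N -> z_normal_form P -> q \in P ->
  variable_ordering s -> x_first s ->
  (abp_width (nx + (ny + nz)) A <= w)%N ->
  exists L, axiom_vectors P w (abp_poly s A) q L.
Proof.
move=> n_gt0 nfP qP so xf le_w.
have [D [szD soundD complD monoD]] := labelled_restrictions nfP qP.
have [t1 [t2 Es]] := x_first_cat so xf.
have size_t1 : (size t1 <= nx + (ny + nz))%N.
  have := perm_size so; rewrite size_enum_ord => <-.
  by rewrite Es size_cat size_map leq_addr.
have [u [v Euv]] : exists (u : 'I_(abp_dim A (size t1)).+1 -> {mpoly F[nx]})
    (v : 'I_(abp_dim A (size t1)).+1 -> {mpoly F[ny + nz]}),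
  abp_poly s A = \sum_k mrename (@lshift nx (ny + nz)) (u k) *
                        mrename (@rshift nx (ny + nz)) (v k).
  rewrite Es /abp_poly.
  have [v /(_ ord0) [u Eu]] := @abp_prod_cut F _ _ _ (@lshift nx (ny + nz))
    (@rshift nx (ny + nz)) t1 t2 _ (abp_mx A) ord0.
  by exists u, v.
(* At most two labelled restrictions of [q], each times at most [w] left factors, whence the bound
   [2 * w]; the label of the restriction is kept. *)
exists [seq (d.1, u k * d.2) | d <- D, k <- enum 'I_(abp_dim A (size t1)).+1].
split.
- rewrite size_allpairs size_enum_ord leq_mul //.
  by apply: leq_trans le_w; apply: abp_dim_width.
- move=> a _ /allpairsP [[d k] /= [dD _ ->]] /= al.
  by exists (u k); rewrite (soundD a d).
- move=> B c a sLB; have [->|[d dD al]] := complD a.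
    by rewrite mulr0; apply: in_span0.
  rewrite Euv rmorph_sum mulr_suml; apply: big_ind => [||k _].
  + exact: in_span0.
  + exact: in_spanD.
  rewrite rmorphM /= xsubst_lshift xsubst_rshift mulrAC mulrC mul_mpolyC.
  apply/in_spanZ/(@in_span_mem _ _ _ _ _ d.1) => //; apply: sLB.
  rewrite -(soundD a d) //.
  by apply/allpairsP; exists (d, k); split; rewrite /= ?mem_enum.
- move=> monoP _ /allpairsP [[d k] /= [dD _ ->]]; exact: (monoD monoP d dD).
Qed.

(** * The span program of a refutation *)

Theorem theorem3p5 (F : fieldType) (b : {poly nat}) :
  exists r : {poly nat},
    forall (nx ny nz : nat)
           (P0 : {fset {mpoly F[nx + nz]}}) (P1 : {fset {mpoly F[ny + nz]}})
           (s : seq 'I_(nx + (ny + nz))) (w : nat),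
      (forall q, q \in P0 ->
         (degree q <= b.[(nx + nz)%N])%N /\ (sparsity q <= b.[(nx + nz)%N])%N) ->
      z_normal_form P0 ->
      variable_ordering s ->
      x_first s ->
      roABP_IPS_LIN_refutation s (joint_system P0 P1) w ->
      exists S : span_program F nz,
        [/\ (sp_size S <= r.[(w * #|` P0|%fset)%N])%N,
            exists I : {ffun 'I_nz -> bool} -> bool,
              sp_computes S I /\ interpolant P0 P1 I
          & monotone_z_normal_form P0 -> sp_monotone S].
Proof.
(* Each axiom of [P0] contributes at most [2 * w] vectors. *)
exists (2%:P * 'X) => nx ny nz P0 P1 s w _ nfP so xf [g [A [Eg sum1 Ew]]].
have disj := refutation_disjoint sum1.
have [n0|n_gt0] := posnP (nx + (ny + nz))%N.
  (* Here [nz = 0], so there is a single assignment, and a constant chosen by whether [P0] has a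
     zero there is an interpolant. *)
  have eq_a (a a' : {ffun 'I_nz -> bool}) : a = a'.
    apply/ffunP => i; case: i => i lt_i; exfalso.
    by move: n0 lt_i => /eqP; rewrite !addn_eq0 => /and3P [_ _ /eqP ->].
  pose a0 : {ffun 'I_nz -> bool} := [ffun=> false].
  have [z0|nz0] := classic (has_bool_zero P0 a0).
    have [S [size_S comp_S mono_S]] := constant_span_program F nz false.
    exists S; split=> //; first by rewrite size_S.
    exists (fun=> false); split=> // a; split=> // z1.
    by case: (disj a) => //; rewrite (eq_a a a0).
  have [S [size_S comp_S mono_S]] := constant_span_program F nz true.
  exists S; split=> //; first by rewrite size_S.
  by exists (fun=> true); split=> // a; split=> //; rewrite (eq_a a a0).
have [L LP] : exists L, forall q, q \in P0 ->
    axiom_vectors P0 w (g (mrename (@xz_var nx ny nz) q)) q (L q).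
  (* Stated for every [q], so that choice yields a total function [L]; outside [P0] any list
     serves. *)
  have exL q : exists L, q \in P0 ->
      axiom_vectors P0 w (g (mrename (@xz_var nx ny nz) q)) q L.
    have [qP|_] := boolP (q \in P0); last by exists [::].
    set q' := mrename _ q.
    have q'Q : q' \in joint_system P0 P1.
      by rewrite in_fsetU; apply/orP; left; apply: in_imfset.
    have [|L ?] := @axiom_vectors_exist _ _ _ _ _ _ _ (A q') w n_gt0 nfP qP so xf.
      by rewrite Ew (bigD1_seq q') ?fset_uniq //= leq_maxl.
    by exists L => _; rewrite Eg.
  exists (fun q => proj1_sig (constructive_indefinite_description _ (exL q))) => q.
  exact: proj2_sig (constructive_indefinite_description _ (exL q)).
pose B : {fset (label nz * {mpoly F[nx]})%type} :=
  seq_fset tt (flatten [seq L q | q <- P0]).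
have inB d : d \in B -> exists2 q, q \in P0 & d \in L q.
  by rewrite seq_fsetE => /flattenP [_ /mapP [q qP ->]]; exists q.
have subB q : q \in P0 -> {subset L q <= B}.
  by move=> qP d dL; rewrite seq_fsetE; apply/flattenP; exists (L q); rewrite ?map_f.
have size_B : (#|` B|%fset <= 2 * (w * #|` P0|%fset))%N.
  rewrite size_seq_fset; apply: leq_trans (size_undup _) _.
  rewrite size_flatten sumnE !big_map mulnA mulnC -sum1_size big_distrl /=.
  rewrite big_seq [leqRHS]big_seq; apply: leq_sum => q qP.
  by rewrite mul1n; have [] := LP q qP.
exists (@SpanProgram F nz {mpoly F[nx]} B 1); split.
- by rewrite hornerM hornerC hornerX; apply: size_B.
(* The interpolant is acceptance itself, made Boolean by excluded middle. *)
- pose acc a := excluded_middle_informative (in_span B a (1 : {mpoly F[nx]})).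
  exists (fun a => if acc a then true else false); split=> a.
    by rewrite /sp_accepts /=; case: (acc a).
  split=> [[x x0]|[c c0]]; case: (acc a) => //.
    move=> acc1.
    (* Each available vector is a multiple of some q(x,a) and vanishes at the common zero, whereas 1
       does not. *)
    have : (1 : {mpoly F[nx]}).@[bool_val F x] = 0 :> F.
      apply: (in_span_eval (phi := meval (bool_val F x))) acc1 => l v /inB [q qP dL] al.
      have [_ snd _ _] := LP q qP.
      have [u /= ->] := snd a _ dL al.
      by rewrite rmorphM /= meval_xsubst x0 ?mulr0.
    by move/eqP; rewrite meval1 oner_eq0.
  (* Under y = c, z = a the identity writes 1 as a sum over the joint system: the terms from [P0]
     are spanned, those from [P1] vanish. *)
  case; have /= := congr1 (xsubst (bool_point F c a)) sum1.
  rewrite rmorph1 => <-; rewrite rmorph_sum big_seq.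
  apply: big_ind => [||q]; [exact: in_span0|exact: in_spanD|].
  rewrite rmorphM => /joint_systemP [] [p pP ->] /=.
    have [_ _ cpl _] := LP p pP.
    by rewrite xsubst_xz; apply: cpl; apply: subB.
  by rewrite xsubst_rshift c0 // mpolyC0 mulr0; apply: in_span0.
- move=> monoP d /inB [q qP dL]; have [_ _ _ mono] := LP q qP.
  exact: mono.
Qed.
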